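(* Consider the online hiring problem with costs drawn i.i.d. from a continuous distribution $X$ on $[0,\infty)$ with $F(0)=0$ that is unknown to the algorithm. Let $\lambda=3$. The following online algorithm (Algorithm 4), which does not use any knowledge of $X$, is strictly $48$-competitive for every such $X$. Initialize $\tau\leftarrow\infty$, $t_{\mathrm{sample}}\leftarrow 0$, $t_{\mathrm{wait}}\leftarrow 1$, $j\leftarrow 0$. For $i=1,\dots,n$: if $t_{\mathrm{sample}}>0$, set $\tau\leftarrow\min\{\tau,x_i\}$ and $t_{\mathrm{sample}}\leftarrow t_{\mathrm{sample}}-1$ (applicant $i$ is not hired); else if $t_{\mathrm{wait}}>0$, set $t_{\mathrm{wait}}\leftarrow t_{\mathrm{wait}}-1$ and, if $x_i\le\tau$, hire applicant $i$ for $(1+\lambda)2^{j+2}$ time steps, stop if $i+(1+\lambda)2^{j+2}>n$, and otherwise set $j\leftarrow j+1$, $\tau\leftarrow\infty$, $t_{\mathrm{sample}}\leftarrow 2^j-1$, $t_{\mathrm{wait}}\leftarrow\max\{1,\lambda t_{\mathrm{sample}}\}$; else set $j\leftarrow j-1$, $\tau\leftarrow\infty$, $t_{\mathrm{sample}}\leftarrow 2^j-1$, $t_{\mathrm{wait}}\leftarrow\max\{1,\lambda t_{\mathrm{sample}}\}$.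
   Context: Online hiring problem: there are $n$ time steps; in time step $i$ applicant $i$ arrives and its cost $x_i$ is revealed, where $x_1,\dots,x_n$ are drawn independently from a distribution $X$. Immediately and irrevocably at time $i$, based only on $x_1,\dots,x_i$ and earlier decisions, the algorithm chooses a nonnegative integer duration $t_i$; applicant $i$ is then under contract during time steps $i,\dots,i+t_i-1$. At every time step $s\in\{1,\dots,n\}$ at least one applicant must be under contract. The cost is $\sum_i t_ix_i$; $\textsc{Alg}_n$ denotes the cost of the online algorithm and $\textsc{Opt}_n$ the minimum cost of a feasible solution knowing all $x_1,\dots,x_n$ in advance. An algorithm is strictly $c$-competitive if $\sup_{n\in\mathbb{N}}\mathbf{E}[\textsc{Alg}_n]/\mathbf{E}[\textsc{Opt}_n]\le c$. *)

(* Defs.v *)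
From HB Require Import structures.
From mathcomp Require Import all_boot all_order all_algebra.
From mathcomp Require Import finmap.
From mathcomp Require Import all_classical all_reals all_analysis.

Set Implicit Arguments.
Unset Strict Implicit.
Unset Printing Implicit Defensive.

Import Order.TTheory GRing.Theory Num.Theory.
Import numFieldNormedType.Exports.

Local Open Scope classical_set_scope.
Local Open Scope ring_scope.

(** Applicants and time steps are numbered from 0: [x i] is the cost of the
    applicant who arrives in time step [i + 1] of the usual 1-based numbering. *)

(* With 0-based indices, a contract of length [t i] covers the time steps
   [i, ..., i + t i - 1]; [i <= s < n] already forces [i < n]. *)
Definition feasible (n : nat) (t : nat -> nat) : Prop :=
  forall s, (s < n)%N -> exists i, (i <= s < i + t i)%N.

Definition hiring_cost (R : realType) (n : nat) (t : nat -> nat) (x : nat -> R)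
    : R :=
  \sum_(i < n) (t i)%:R * x i.

(* For nonnegative costs the infimum is a minimum. *)
Definition opt (R : realType) (n : nat) (x : nat -> R) : R :=
  inf [set hiring_cost n t x | t in feasible n].

(* [ostep n i xi s] processes the [i]-th applicant (with [i] counted from 1),
   of cost [xi], in state [s] and with horizon [n]; it returns the next state
   and the duration of the contract offered to this applicant. Since the state
   type is arbitrary, the whole history of costs and decisions may be stored. *)
Record online_algorithm (R : realType) := OnlineAlgorithm {
  ostate : Type ;
  oinit : ostate ;
  ostep : nat -> nat -> R -> ostate -> ostate * nat }.

Fixpoint state_before (R : realType) (A : online_algorithm R) (n : nat)
    (x : nat -> R) (i : nat) : ostate A :=
  if i is k.+1 then (ostep n k.+1 (x k) (state_before A n x k)).1 else oinit A.

Definition durations (R : realType) (A : online_algorithm R) (n : nat)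
    (x : nat -> R) (i : nat) : nat :=
  (ostep n i.+1 (x i) (state_before A n x i)).2.

Definition alg (R : realType) (A : online_algorithm R) (n : nat) (x : nat -> R)
    : R :=
  hiring_cost n (durations A n x) x.

Definition always_feasible (R : realType) (A : online_algorithm R) : Prop :=
  forall (n : nat) (x : nat -> R),
    (forall i, 0 <= x i) -> feasible n (durations A n x).

(* In [\bar R], [r / +oo = 0] for every [r], including [+oo]. So the horizons
   for which [opt] has an infinite expectation, where the ratio is not defined,
   impose no constraint. *)
Definition strictly_competitive (R : realType) (d : measure_display)
    (T : measurableType d) (P : probability T R) (X : nat -> {RV P >-> R})
    (A : online_algorithm R) (c : R) : Prop :=
  (ereal_sup [set 'E_P[fun w => alg A n (fun i => X i w)] /
                  'E_P[fun w => opt n (fun i => X i w)]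
             | n in [set n : nat | (0 < n)%N]] <= c%:E)%E.

Definition mutually_independent (R : realType) (d : measure_display)
    (T : measurableType d) (P : probability T R) (X : nat -> {RV P >-> R})
    : Prop :=
  forall (J : {fset nat}) (B : nat -> set R),
    (forall i, measurable (B i)) ->
    (P (\bigcap_(i in [set` J]) (X i @^-1` B i))
     = \prod_(i <- J) P (X i @^-1` B i))%E.

Definition iid (R : realType) (mu : probability R R) (d : measure_display)
    (T : measurableType d) (P : probability T R) (X : nat -> {RV P >-> R})
    : Prop :=
  mutually_independent X /\
  (forall i (B : set R), measurable B -> distribution P (X i) B = mu B).

(* [sw_phase] is the variable [j]. Its truncated predecessor is only computed
   when it is positive: in phase 0 the threshold is [+oo] and the unique waiting
   step always hires. [sw_stopped] records that the algorithm has stopped. *)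
Record sw_state (R : realType) := SWState {
  sw_tau : \bar R ;
  sw_sample : nat ;
  sw_wait : nat ;
  sw_phase : nat ;
  sw_stopped : bool }.

Definition sw_start (R : realType) (lam j : nat) : sw_state R :=
  let ts := (2 ^ j - 1)%N in
  SWState (+oo : \bar R)%E ts (maxn 1 (lam * ts)) j false.

Definition sw_step (R : realType) (lam n i : nat) (xi : R) (s : sw_state R)
    : sw_state R * nat :=
  let: SWState tau ts tw j stopped := s in
  if stopped then (s, 0%N)
  else if (0 < ts)%N then
    (SWState (Order.min tau xi%:E) (ts - 1) tw j false, 0%N)
  else if (0 < tw)%N then
    if (xi%:E <= tau)%E then
      let t := ((1 + lam) * 2 ^ (j + 2))%N in
      if (n < i + t)%N then (SWState tau ts (tw - 1) j true, t)
      else (sw_start R lam (j + 1), t)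
    else (SWState tau ts (tw - 1) j false, 0%N)
  else (sw_start R lam (j - 1), 0%N).

Definition sample_wait_algorithm (R : realType) (lam : nat)
    : online_algorithm R :=
  OnlineAlgorithm (SWState (+oo : \bar R)%E 0 1 0 false) (@sw_step R lam).

(* Main.v *)
(* Let [M s] be the mean of the minimum of [s] samples. A time step [s] can only
   be covered by one of the first [s] applicants, so E[Opt] >= M 1 + ... + M n.

   The law of the minimum of [k] samples has density [k * survival ^ (k - 1)],
   where [survival t] is the probability that a sample exceeds [t]. Integrating
   against it shows that a phase with [k = 2 ^ j - 1 > 0] samples and [3 k]
   waiting steps hires with probability 3/4, and that the hired cost [x]
   satisfies E[x; hire] = sum_(i < 3 k) k / ((k + i) (k + i + 1)) M (k + i + 1),
   which telescopes to at most 3/4 * M (2 ^ j). The phase number is thus a random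
   walk with up-probability 3/4 reflected at 0, which succeeds 3/2 times on
   average in each phase, so that
   E[Alg] <= 24 * sum_(2 ^ j <= n) 2 ^ j M (2 ^ j) <= 48 * (M 1 + ... + M n)
   because [M] is nonincreasing. Formally, [state_value] is a supermartingale
   bounding the expected remaining cost. *)

Require Import Defs.
From mathcomp Require Import all_boot all_order all_algebra.
From mathcomp Require Import finmap.
From mathcomp Require Import all_classical all_reals all_analysis.
From mathcomp Require Import measurable_realfun.
From mathcomp Require Import zify ring lra.

Set Implicit Arguments.
Unset Strict Implicit.
Unset Printing Implicit Defensive.

Import Order.TTheory GRing.Theory Num.Theory.
Import numFieldNormedType.Exports.

Local Open Scope classical_set_scope.
Local Open Scope ring_scope.

(** * Feasibility *)

(* Number of steps in which a run entered at the start of phase [j] is sure to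
   hire: phase [j] and then each lower phase may fail, phase 0 never does. *)
Fixpoint phase_deadline (j : nat) : nat :=
  if j is j'.+1 then (4 * (2 ^ j - 1) + 1 + phase_deadline j')%N else 1%N.

(** Yields [phase_deadline (j + 1) <= 16 * 2 ^ j]: a contract signed in phase [j] outlasts the worst
    case of phase [j + 1]. *)
Lemma phase_deadline_closed j : (phase_deadline j + 3 * j + 7 = 8 * 2 ^ j)%N.
Proof.
elim: j => [//|j IH]; rewrite /=.
have := expn_gt0 2 j; rewrite expnS /=; lia.
Qed.

(** Worst case, with every threshold test failing down to phase 0. The extra [1] is the step that
    lowers the phase and tests no applicant. *)
Definition steps_to_hire (R : realType) (s : sw_state R) : nat :=
  (sw_sample s + sw_wait s
   + (if sw_phase s is j.+1 then 1 + phase_deadline j else 0))%N.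

Lemma steps_to_hire_start (R : realType) j :
  steps_to_hire (sw_start R 3 j) = phase_deadline j.
Proof.
rewrite /steps_to_hire /=; case: j => [//|j] /=.
have : (2 <= 2 ^ j.+1)%N by rewrite expnS; have := expn_gt0 2 j; lia.
move: (phase_deadline j) (2 ^ j.+1)%N => a b; lia.
Qed.

Definition phase0_hires (R : realType) (s : sw_state R) : Prop :=
  sw_phase s = 0%N -> [/\ sw_sample s = 0%N, sw_wait s = 1%N & sw_tau s = +oo%E].

Lemma phase0_hires_start (R : realType) j : phase0_hires (sw_start R 3 j).
Proof. by rewrite /phase0_hires /= => ->. Qed.

(** The contracts so far cover the steps below [c], and the latest possible next hire, in step
    [i + steps_to_hire s - 1], is at [c] at the latest, so its contract leaves no gap. *)
Lemma sample_wait_invariant (R : realType) n (x : nat -> R) i :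
  let A := sample_wait_algorithm R 3 in
  let s := state_before A n x i in
  let t := durations A n x in
  (sw_stopped s -> feasible n t) /\
  (~~ sw_stopped s ->
     phase0_hires s /\
     exists2 c, feasible c t & (i + steps_to_hire s <= c.+1)%N).
Proof.
move=> A s t; rewrite {}/s.
elim: i => [|i [IHstop IHrun]].
  split=> //= _; split=> //.
  by exists 0%N.
have def_t : t i = (sw_step 3 n i.+1 (x i) (state_before A n x i)).2 by [].
have -> : state_before A n x i.+1
        = (sw_step 3 n i.+1 (x i) (state_before A n x i)).1 by [].
move: (state_before A n x i) IHstop IHrun def_t => [tau ts tw j st].
case: st => /= [IHstop _ _|_ /(_ isT) [h0 [c hc hic]] def_t].
  by split.
have hire_cover d : t i = d -> (i <= c)%N -> feasible (i + d) t.
  move=> td ic m hm; have [mc|cm] := ltnP m c; first exact: hc.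
  by exists i; rewrite td; lia.
rewrite /steps_to_hire /phase0_hires /= in h0 hic.
have hj_gt0 : ts = 0%N -> tw = 0%N -> (0 < j)%N.
  by move=> _ tw0; case: j h0 hic {def_t} => // h0; case: (h0 erefl); lia.
case: ifP def_t => ts0 /=.
  move=> _; split=> // _; split.
    by move=> /= j0; case: (h0 j0) => e; rewrite e in ts0.
  by exists c => //; rewrite /steps_to_hire /=; lia.
have {}ts0 : ts = 0%N by lia.
case: ifP => tw0 /=; last first.
  move=> _; split=> // _; split; first exact: phase0_hires_start.
  exists c => //; rewrite steps_to_hire_start.
  have := hj_gt0 ts0; case: j hic {h0 hj_gt0} => [|j] /= ; first lia.
  by rewrite subn1 /=; lia.
case: ifP => xtau /=; last first.
  move=> _; split=> // _; split.
    by move=> /= j0; case: (h0 j0) => _ _ e; rewrite e leey in xtau.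
  by exists c => //; rewrite /steps_to_hire /=; lia.
have ic : (i <= c)%N.
  by move: hic; case: (j) => [|k] /=; lia.
case: ifP => stop /= td; split=> //.
  by move=> _ m hm; apply: (hire_cover _ td ic); lia.
move=> _; split; first exact: phase0_hires_start.
exists (i + 4 * 2 ^ (j + 2))%N; first exact: hire_cover.
rewrite steps_to_hire_start.
have := phase_deadline_closed (j + 1); rewrite !expnD.
lia.
Qed.

Lemma sample_wait_feasible (R : realType) :
  always_feasible (sample_wait_algorithm R 3).
Proof.
move=> n x _ m mn.
have [stopped running] := sample_wait_invariant n x n.
move: stopped running.
set s := state_before _ n x n => stopped running.
have [/stopped|/running [h0 [c hc hnc]]] := boolP (sw_stopped s); first exact.
apply: hc; move: hnc; rewrite /steps_to_hire.
(* A running state has at least one step to go, so [n <= c]; in phase 0 this is the single waiting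
   step. *)
case E : (sw_phase s) => [|j]; first by case: (h0 E) => _ -> _; lia.
by lia.
Qed.

(** The phase rises from [j] only if a contract of length [16 * 2 ^ j] fits into the horizon. Hence
    levels [l] with [2 ^ l <= n] suffice in the potential. *)
Lemma sample_wait_phase_bound (R : realType) n (x : nat -> R) i : (0 < n)%N ->
  (2 ^ sw_phase (state_before (sample_wait_algorithm R 3) n x i) <= n)%N.
Proof.
move=> n0; elim: i => [//|i].
have -> : state_before (sample_wait_algorithm R 3) n x i.+1
        = (sw_step 3 n i.+1 (x i) (state_before (sample_wait_algorithm R 3) n x i)).1 by [].
case: (state_before _ n x i) => tau ts tw j st /= IH.
case: ifP => // _; case: ifP => // _; case: ifP => _ /=; last first.
  by apply: leq_trans IH; rewrite leq_exp2l// leq_subr.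
case: ifP => // _; case: ifP => //= /negbT; rewrite -leqNgt => le_n.
apply: leq_trans le_n; rewrite !expnD; lia.
Qed.

(** * The law of the minimum *)

Section order_measurability.
Context (d : measure_display) (T : measurableType d) (R : realType).
Local Open Scope ereal_scope.
Implicit Types f g : T -> \bar R.

Lemma measurable_fun_lee f g : measurable_fun setT f -> measurable_fun setT g ->
  measurable_fun setT (fun x => f x <= g x).
Proof.
move=> mf mg; apply: (measurable_fun_bool true).
by rewrite setTI; have := measurable_lee measurableT mf mg; rewrite setTI.
Qed.

Lemma measurable_fun_lte f g : measurable_fun setT f -> measurable_fun setT g ->
  measurable_fun setT (fun x => f x < g x).
Proof.
move=> mf mg; apply: (measurable_fun_bool true).
by rewrite setTI; have := measurable_lte measurableT mf mg; rewrite setTI.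
Qed.

(** The integral of a nonnegative function is a supremum over simple functions below it. This allows
    bounds on [alg] and [opt] without establishing their measurability. *)
Lemma ge0_le_integral_nonmeasurable (m : {measure set T -> \bar R}) f g :
  (forall x, 0 <= f x) -> (forall x, f x <= g x) ->
  \int[m]_x f x <= \int[m]_x g x.
Proof.
move=> f0 fg; have g0 x : 0 <= g x by apply: le_trans (f0 x) (fg x).
rewrite !ge0_integralE//; apply: ereal_sup_le => _ [h /= hf <-].
exists h => //= x; apply: le_trans (hf x) _; rewrite !patchE; case: ifP => //.
Qed.
End order_measurability.

Section minimum_law.
Context (R : realType) (mu : probability R R).
Hypothesis no_atom : forall r, mu [set r] = 0%E.
Local Open Scope ereal_scope.

Definition survival (t : \bar R) : R := fine (mu [set x | t < x%:E]).

Lemma measurable_gt t : measurable [set x : R | t < x%:E].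
Proof.
have := measurable_lte measurableT (@measurable_cst _ _ R _ setT t)
  (@EFin_measurable R setT).
by rewrite setTI.
Qed.

Lemma survivalE t : (survival t)%:E = mu [set x | t < x%:E].
Proof. by rewrite /survival fineK// fin_num_measure//; exact: measurable_gt. Qed.

Lemma survival_ge0 t : (0 <= survival t)%R.
Proof. exact/fine_ge0/measure_ge0. Qed.

Lemma survival_le1 t : (survival t <= 1)%R.
Proof.
by rewrite -lee_fin survivalE; apply: probability_le1; exact: measurable_gt.
Qed.

Lemma survival_pinfty : survival +oo = 0%R.
Proof.
rewrite /survival (_ : [set _ | _] = set0) ?measure0//.
by apply/seteqP; split => x //=.
Qed.

Lemma integral_survival t (c : \bar R) : 0 <= c ->
  \int[mu]_x (if t < x%:E then c else 0) = c * (survival t)%:E.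
Proof.
move=> c0; rewrite survivalE -integral_cst; last exact: measurable_gt.
rewrite [RHS]integral_mkcond; apply: eq_integral => x _.
rewrite patchE; case: ifPn => h; first by rewrite ifT// inE.
by rewrite ifF//; apply/negbTE; rewrite notin_setE /=; apply/negP.
Qed.

Lemma measurable_survival : measurable_fun setT survival.
Proof.
apply/measurable_EFinP.
have -> : EFin \o survival
        = fubini_F mu (fun z : \bar R * R => if z.1 < z.2%:E then 1 else 0).
  apply/funext => t /=; rewrite /fubini_F /=.
  by rewrite integral_survival// mul1e.
apply: measurable_fun_fubini_tonelli_F => [|z]; last by case: ifP.
apply: measurable_fun_ifT => //.
by apply: measurable_fun_lte => //; exact/measurable_EFinP.
Qed.

Lemma measurable_survivalX (n : nat) (r : R) :
  measurable_fun setT (fun x : R => (r * survival x%:E ^+ n)%:E).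
Proof.
apply/measurable_EFinP; apply: measurable_funM => //.
apply: measurable_funX.
exact: (measurableT_comp measurable_survival (@EFin_measurable R setT)).
Qed.

(** The integrands differ only at [y], a null set because [mu] has no atoms. *)
Lemma integral_ge_gt (y : R) (f : R -> \bar R) : measurable_fun setT f ->
  \int[mu]_x (if (y <= x)%R then f x else 0)
  = \int[mu]_x (if (y < x)%R then f x else 0).
Proof.
move=> mf; apply: ae_eq_integral => //.
- by apply: measurable_fun_ifT => //; exact: measurable_fun_ler.
- by apply: measurable_fun_ifT => //; exact: measurable_fun_ltr.
exists [set y]; split; [exact: measurable_set1|exact: no_atom|].
move=> x /= /not_implyP[_].
by case: (ltgtP y x).
Qed.

Lemma integral_ge_survival (y : R) (c : \bar R) : 0 <= c ->
  \int[mu]_x (if (y <= x)%R then c else 0) = c * (survival y%:E)%:E.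
Proof.
by move=> c0; rewrite integral_ge_gt// -integral_survival.
Qed.

(** Mean of [g] at the minimum of [t] and [s] fresh samples. The iterated integral unfolds in step
    with the sampling of the algorithm. *)
Fixpoint running_min_mean (s : nat) (g : \bar R -> \bar R) (t : \bar R) : \bar R :=
  if s is s'.+1 then \int[mu]_x running_min_mean s' g (mine t x%:E) else g t.

Lemma running_min_mean_ge0 s g : (forall t, 0 <= g t) ->
  forall t, 0 <= running_min_mean s g t.
Proof. by move=> g0; elim: s => // s IH t /=; apply: integral_ge0. Qed.

Lemma measurable_running_min_mean s g : (forall t, 0 <= g t) ->
  measurable_fun setT g -> measurable_fun setT (running_min_mean s g).
Proof.
move=> g0 mg; elim: s => // s IH.
apply: (@measurable_fun_fubini_tonelli_F _ _ _ _ R mu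
  (fun z : \bar R * R => running_min_mean s g (mine z.1 z.2%:E))) => [|z].
  apply: (measurableT_comp IH); apply: measurable_mine => //.
  exact/measurable_EFinP.
exact: running_min_mean_ge0.
Qed.

Lemma measurable_mine_EFin t : measurable_fun setT (fun x : R => mine t x%:E).
Proof. by apply: measurable_mine => //; exact: EFin_measurable. Qed.

(* The law of the minimum of [s] samples, truncated at [t], has the density
   [s * survival ^ (s - 1)] below [t] and mass [survival t ^ s] at [t]. *)
Lemma running_min_meanE s g t : (forall t, 0 <= g t) -> measurable_fun setT g ->
  running_min_mean s g t = g t * (survival t ^+ s)%:E
    + \int[mu]_x (if x%:E <= t
                  then g x%:E * (s%:R * survival x%:E ^+ s.-1)%:E else 0).
Proof.
move=> g0 mg.
have mgE : measurable_fun setT (fun x : R => g x%:E).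
  exact: (measurableT_comp mg (@EFin_measurable R setT)).
have dens_ge0 n x : 0 <= g x%:E * (n%:R * survival x%:E ^+ n.-1)%:E.
  by rewrite mule_ge0// lee_fin mulr_ge0// exprn_ge0// survival_ge0.
have mdens n m : measurable_fun setT
    (fun x : R => g x%:E * (n%:R * survival x%:E ^+ m)%:E).
  by apply: emeasurable_funM => //; exact: measurable_survivalX.
have mle : measurable_fun setT (fun x : R => x%:E <= t).
  by apply: measurable_fun_lee => //; exact: EFin_measurable.
elim: s t mle => [|s IH] t mle.
  rewrite expr0 mule1 integral0_eq ?adde0// => x _.
  by rewrite mul0r mule0 if_same.
pose k y := g y%:E * (s%:R * survival y%:E ^+ s.-1)%:E.
rewrite /= (eq_integral (fun x => g (mine t x%:E) * (survival (mine t x%:E) ^+ s)%:E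
    + \int[mu]_y (if y%:E <= mine t x%:E then k y else 0))); last first.
  by move=> x _; rewrite IH//; apply: measurable_fun_lee.
have mgs : measurable_fun setT
    (fun x : R => g (mine t x%:E) * (survival (mine t x%:E) ^+ s)%:E).
  apply: emeasurable_funM.
    exact: (measurableT_comp mg (measurable_mine_EFin t)).
  apply/measurable_EFinP; apply: measurable_funX.
  exact: (measurableT_comp measurable_survival (measurable_mine_EFin t)).
pose F (z : R * R) := if z.2%:E <= mine t z.1%:E then k z.2 else 0.
have F0 z : 0 <= F z by rewrite /F; case: ifP => // _; exact: dens_ge0.
have mF : measurable_fun setT F.
  apply: measurable_fun_ifT => //.
    apply: measurable_fun_lee; first exact/measurable_EFinP.
    apply: measurable_mine => //; exact/measurable_EFinP.
  exact: (measurableT_comp (mdens s s.-1) measurable_snd).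
rewrite ge0_integralD//; first last.
- exact: (@measurable_fun_fubini_tonelli_F _ _ _ _ R mu F).
- by move=> x _; apply: integral_ge0 => y _; exact: (F0 (x, y)).
- by move=> x _; rewrite mule_ge0// lee_fin exprn_ge0// survival_ge0.
(* By Tonelli: [y <= min t x] means [y <= t] and [y <= x], and the latter has probability
   [survival y]. *)
have -> : \int[mu]_x \int[mu]_y (if y%:E <= mine t x%:E then k y else 0)
   = \int[mu]_y (if y%:E <= t then k y * (survival y%:E)%:E else 0).
  rewrite (@fubini_tonelli _ _ _ _ R mu mu F mF F0).
  apply: eq_integral => y _; rewrite /F /=; case: ifPn => yt.
    rewrite -integral_ge_survival; last exact: dens_ge0.
    by apply: eq_integral => x _; rewrite le_min yt /=.
  by apply: integral0_eq => x _; rewrite le_min (negbTE yt).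
(* The event [t < x] contributes the mass at [t]. *)
have -> : \int[mu]_x (g (mine t x%:E) * (survival (mine t x%:E) ^+ s)%:E)
   = g t * (survival t ^+ s.+1)%:E
     + \int[mu]_x (if x%:E <= t then g x%:E * (survival x%:E ^+ s)%:E else 0).
  rewrite exprSr EFinM muleA -integral_survival; last first.
    by rewrite mule_ge0// lee_fin exprn_ge0// survival_ge0.
  rewrite -ge0_integralD//; first last.
  - apply: measurable_fun_ifT => //.
    by have := mdens 1%N s; under eq_fun do rewrite mul1r.
  - by move=> x _; case: ifP => // _; rewrite mule_ge0// lee_fin exprn_ge0// survival_ge0.
  - apply: measurable_fun_ifT => //.
    by apply: measurable_fun_lte => //; exact: EFin_measurable.
  - by move=> x _; case: ifP => // _; rewrite mule_ge0// lee_fin exprn_ge0// survival_ge0.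
  apply: eq_integral => x _.
  by case: (leP x%:E t) => tx; rewrite ?adde0 ?add0e.
rewrite -addeA; congr (_ + _); rewrite -ge0_integralD//; first last.
- apply: measurable_fun_ifT => //; apply: emeasurable_funM => //.
    exact: mdens.
  by have := measurable_survivalX 1 1; under eq_fun do rewrite mul1r expr1.
- move=> x _; case: ifP => // _; rewrite mule_ge0 ?dens_ge0//.
  by rewrite lee_fin survival_ge0.
- apply: measurable_fun_ifT => //.
  by have := mdens 1%N s; under eq_fun do rewrite mul1r.
- by move=> x _; case: ifP => // _; rewrite mule_ge0// lee_fin exprn_ge0// survival_ge0.
apply: eq_integral => x _; case: ifP => _; last by rewrite adde0.
rewrite /k -muleA -EFinM -ge0_muleDr ?lee_fin ?mulr_ge0 ?exprn_ge0 ?survival_ge0//.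
rewrite -EFinD; congr (_ * _%:E).
case: s {IH k mgs F F0 mF} => [|s] /=; first by ring.
by rewrite [s.+2%:R]mulrSr exprSr; ring.
Qed.

Lemma running_min_mean_pinfty s g : (forall t, 0 <= g t) -> measurable_fun setT g ->
  running_min_mean s.+1 g +oo
  = \int[mu]_x (g x%:E * (s.+1%:R * survival x%:E ^+ s)%:E).
Proof.
move=> g0 mg; rewrite running_min_meanE//.
rewrite survival_pinfty expr0n /= mule0 add0e.
by apply: eq_integral => x _; rewrite leey.
Qed.

Lemma running_min_mean_cst1 s t : running_min_mean s (fun=> 1) t = 1.
Proof.
elim: s t => //= s IH t.
rewrite (eq_integral (cst 1)); last by move=> x _; rewrite IH.
by rewrite integral_cst// mul1e; exact: probability_setT.
Qed.

Lemma integral_survivalX n :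
  \int[mu]_x (n.+1%:R * survival x%:E ^+ n)%:E = 1.
Proof.
rewrite -(running_min_mean_cst1 n.+1 +oo) running_min_mean_pinfty//.
by apply: eq_integral => x _; rewrite mul1e.
Qed.

(** The tail of the law of a minimum: both sides complement the same finite integral [J] over
    [x <= y] to total mass 1. *)
Lemma integral_survivalX_ge n (y : R) :
  \int[mu]_x (if (y <= x)%R then (n.+1%:R * survival x%:E ^+ n)%:E else 0)
  = (survival y%:E ^+ n.+1)%:E.
Proof.
have f0 x : 0 <= (n.+1%:R * survival x%:E ^+ n)%:E.
  by rewrite lee_fin mulr_ge0// exprn_ge0// survival_ge0.
rewrite integral_ge_gt; last exact: measurable_survivalX.
set I := LHS; set a := survival y%:E.
pose J := \int[mu]_x (if (x <= y)%R then (n.+1%:R * survival x%:E ^+ n)%:E else 0).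
have J0 : 0 <= J by apply: integral_ge0 => x _; case: ifP.
have aJ : (a ^+ n.+1)%:E + J = 1.
  have := running_min_mean_cst1 n.+1 y%:E.
  rewrite running_min_meanE// mul1e => <-; congr (_ + _).
  by apply: eq_integral => x _; rewrite mul1e.
have IJ : I + J = 1.
  rewrite -(integral_survivalX n) -ge0_integralD//; first last.
  - apply: measurable_fun_ifT => //; last exact: measurable_survivalX.
    exact: measurable_fun_ler.
  - by move=> x _; case: ifP.
  - apply: measurable_fun_ifT => //; last exact: measurable_survivalX.
    exact: measurable_fun_ltr.
  - by move=> x _; case: ifP.
  by apply: eq_integral => x _; case: ltP => _; rewrite ?adde0 ?add0e.
have Jfin : J \is a fin_num.
  rewrite ge0_fin_numE//; apply: (@le_lt_trans _ _ 1); last by rewrite ltry.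
  by rewrite -aJ leeDr// lee_fin exprn_ge0// survival_ge0.
by rewrite -(addeK I Jfin) IJ -aJ addeK.
Qed.

(** * Means of minima *)

(** Keeps integrands nonnegative everywhere, as Tonelli requires; negative costs will form a null
    event. *)
Definition pos_part (t : \bar R) : \bar R := maxe t 0.

Lemma pos_part_ge0 t : 0 <= pos_part t.
Proof. by rewrite le_max lexx orbT. Qed.

Lemma measurable_pos_part : measurable_fun setT pos_part.
Proof. exact: measurable_maxe. Qed.

Definition mean_min (s : nat) : \bar R := running_min_mean s pos_part +oo.

Lemma mean_min_ge0 s : 0 <= mean_min s.
Proof. exact/running_min_mean_ge0/pos_part_ge0. Qed.

Lemma mean_minE s :
  mean_min s.+1 = \int[mu]_x (pos_part x%:E * (s.+1%:R * survival x%:E ^+ s)%:E).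
Proof.
exact: (running_min_mean_pinfty _ pos_part_ge0 measurable_pos_part).
Qed.

Lemma running_min_mean_mono s g : (forall t, 0 <= g t) ->
  {homo g : t u / t <= u} ->
  {homo running_min_mean s g : t u / t <= u}.
Proof.
move=> g0 hg; elim: s => // s IH t u tu /=.
apply: ge0_le_integral_nonmeasurable => x; first exact: running_min_mean_ge0.
by apply: IH; rewrite le_min !ge_min tu lexx orbT.
Qed.

(** The first sample can only lower the threshold from [+oo], and [running_min_mean] is monotone in
    the threshold. *)
Lemma mean_min_decr s : mean_min s.+1 <= mean_min s.
Proof.
rewrite /mean_min /= -[leRHS]mule1 -(@probability_setT _ _ _ mu).
rewrite -[leRHS]integral_cst//.
apply: ge0_le_integral_nonmeasurable => x.
  exact/running_min_mean_ge0/pos_part_ge0.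
apply: running_min_mean_mono; last by rewrite leey.
- exact: pos_part_ge0.
- move=> t u tu; rewrite /pos_part ge_max !le_max tu lexx.
  by rewrite orbT.
Qed.

Definition lower_mean (t : \bar R) : \bar R :=
  \int[mu]_x (if x%:E <= t then pos_part x%:E else 0).

Lemma lower_mean_ge0 t : 0 <= lower_mean t.
Proof. by apply: integral_ge0 => x _; case: ifP => // _; exact: pos_part_ge0. Qed.

Lemma measurable_pos_part_EFin : measurable_fun setT (fun x : R => pos_part x%:E).
Proof. exact: (measurableT_comp measurable_pos_part (@EFin_measurable R setT)). Qed.

Lemma measurable_lower_mean : measurable_fun setT lower_mean.
Proof.
apply: (@measurable_fun_fubini_tonelli_F _ _ _ _ R mu
  (fun z : \bar R * R => if z.2%:E <= z.1 then pos_part z.2%:E else 0)) => [|z].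
  apply: measurable_fun_ifT => //.
    by apply: measurable_fun_lee => //; exact/measurable_EFinP.
  exact: (measurableT_comp measurable_pos_part_EFin measurable_snd).
by case: ifP => // _; exact: pos_part_ge0.
Qed.

Lemma measurable_lower_meanX (i : nat) :
  measurable_fun setT (fun t => lower_mean t * (survival t ^+ i)%:E).
Proof.
apply: emeasurable_funM; first exact: measurable_lower_mean.
exact/measurable_EFinP/measurable_funX/measurable_survival.
Qed.

(** After [k.+1] samples and [i] rejections, the next step hires when its cost is the minimum of all
    values seen and the minimum of the earlier ones is a sample. The factor is the product of these
    probabilities, [1 / (k.+1 + i).+1] and [k.+1 / (k.+1 + i)]. *)
Lemma running_min_mean_lower_mean k i :
  running_min_mean k.+1 (fun t => lower_mean t * (survival t ^+ i)%:E) +oo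
  = (k.+1%:R / ((k.+1 + i)%:R * (k.+1 + i).+1%:R))%:E * mean_min (k.+1 + i).+1.
Proof.
rewrite running_min_mean_pinfty; first last.
- exact: measurable_lower_meanX.
- move=> t; rewrite mule_ge0 ?lower_mean_ge0// lee_fin.
  by rewrite exprn_ge0// survival_ge0.
rewrite addSn; set N := (k + i)%N.
(* [r] turns the weight [k.+1 * survival ^ N] into the density of the minimum of [N.+1] samples. *)
pose r : R := (k.+1%:R / N.+1%:R)%R.
have r0 : (0 <= r)%R by rewrite divr_ge0.
pose dens (y : R) := (N.+1%:R * survival y%:E ^+ N)%:E.
have dens0 y : 0 <= dens y by rewrite lee_fin mulr_ge0// exprn_ge0// survival_ge0.
pose F (z : R * R) := if (z.2 <= z.1)%R then pos_part z.2%:E * dens z.1 else 0.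
have F0 z : 0 <= F z.
  by rewrite /F; case: ifP => // _; rewrite mule_ge0// pos_part_ge0.
have mF : measurable_fun setT F.
  apply: measurable_fun_ifT => //; first exact: measurable_fun_ler.
  apply: emeasurable_funM.
    exact: (measurableT_comp measurable_pos_part_EFin measurable_snd).
  exact: (measurableT_comp (measurable_survivalX N N.+1%:R) measurable_fst).
transitivity (\int[mu]_x (r%:E * \int[mu]_y F (x, y))).
  apply: eq_integral => x _.
  have -> : \int[mu]_y F (x, y) = lower_mean x%:E * dens x.
    rewrite muleC -ge0_integralZl//; first last.
    - by move=> y _; case: ifP => // _; exact: pos_part_ge0.
    - apply: measurable_fun_ifT => //; last exact: measurable_pos_part_EFin.
      by apply: measurable_fun_lee => //; exact: EFin_measurable.
    apply: eq_integral => y _; rewrite /F /= lee_fin; case: ifP => _.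
      by rewrite muleC.
    by rewrite mule0.
  rewrite -muleA -EFinM muleCA; congr (_ * _); rewrite -EFinM; congr EFin.
  rewrite [RHS]mulrA (_ : (r * _ = k.+1%:R)%R); last by rewrite divfK ?pnatr_eq0.
  by rewrite /N exprD; ring.
rewrite ge0_integralZl//; first last.
- by move=> x _; apply: integral_ge0 => y _; exact: F0.
- exact: (@measurable_fun_fubini_tonelli_F _ _ _ _ R mu F).
(* Integrating the threshold over [y <= x] first leaves [survival y ^+ N.+1], which up to a factor
   [N.+2] is the density of the minimum of [N.+2] samples. *)
rewrite (@fubini_tonelli _ _ _ _ R mu mu F mF F0).
have -> : \int[mu]_y \int[mu]_x F (x, y)
        = (N.+2%:R^-1)%:E * mean_min N.+2.
  rewrite mean_minE -ge0_integralZl ?lee_fin//; first last.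
  - move=> x _; rewrite mule_ge0 ?pos_part_ge0// lee_fin.
    by rewrite mulr_ge0// exprn_ge0// survival_ge0.
  - apply: emeasurable_funM; first exact: measurable_pos_part_EFin.
    exact: measurable_survivalX.
  apply: eq_integral => y _.
  transitivity (pos_part y%:E * (survival y%:E ^+ N.+1)%:E).
    rewrite -integral_survivalX_ge -ge0_integralZl//; first last.
    - exact: pos_part_ge0.
    - by move=> x _; case: ifP => // _; exact: dens0.
    - apply: measurable_fun_ifT => //; last exact: measurable_survivalX.
      exact: measurable_fun_ler.
    by apply: eq_integral => x _; rewrite /F /=; case: ifP => // _; rewrite mule0.
  rewrite muleCA; congr (_ * _); rewrite -EFinM; congr EFin.
  by rewrite mulrA mulVf ?mul1r// pnatr_eq0.
rewrite muleA -EFinM; congr ((_)%:E * _).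
by rewrite /r invfM mulrA.
Qed.

End minimum_law.

(** * The value of a phase *)

Section phase_value.
Context (R : realType) (mu : probability R R).
Hypothesis no_atom : forall r, mu [set r] = 0%E.
Local Open Scope ereal_scope.
Local Notation surv := (survival mu).

Lemma running_min_meanD s f g : (forall t, 0 <= f t) -> measurable_fun setT f ->
  (forall t, 0 <= g t) -> measurable_fun setT g ->
  forall t, running_min_mean mu s (f \+ g) t
          = running_min_mean mu s f t + running_min_mean mu s g t.
Proof.
move=> f0 mf g0 mg; elim: s => // s IH t /=.
rewrite (eq_integral _ _ (fun x _ => IH (mine t x%:E))) ge0_integralD//.
- by move=> x _; exact: running_min_mean_ge0.
- exact: (measurableT_comp (measurable_running_min_mean mu s f0 mf)
    (measurable_mine_EFin t)).
- by move=> x _; exact: running_min_mean_ge0.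
- exact: (measurableT_comp (measurable_running_min_mean mu s g0 mg)
    (measurable_mine_EFin t)).
Qed.

Lemma running_min_meanZ s (a : R) g : (0 <= a)%R ->
  (forall t, 0 <= g t) -> measurable_fun setT g ->
  forall t, running_min_mean mu s (fun u => a%:E * g u) t
          = a%:E * running_min_mean mu s g t.
Proof.
move=> a0 g0 mg; elim: s => // s IH t /=.
rewrite (eq_integral _ _ (fun x _ => IH (mine t x%:E))) ge0_integralZl//.
- exact: (measurableT_comp (measurable_running_min_mean mu s g0 mg)
    (measurable_mine_EFin t)).
- by move=> x _; exact: running_min_mean_ge0.
Qed.

Lemma running_min_mean_sum s n (g : nat -> \bar R -> \bar R) :
  (forall i t, 0 <= g i t) -> (forall i, measurable_fun setT (g i)) ->
  forall t, running_min_mean mu s (fun u => \sum_(i < n) g i u) t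
          = \sum_(i < n) running_min_mean mu s (g i) t.
Proof.
move=> g0 mg; elim: s => [//|s IH] t /=.
rewrite (eq_integral _ _ (fun x _ => IH (mine t x%:E))) ge0_integral_sum//.
- move=> i; exact: (measurableT_comp (measurable_running_min_mean mu s (g0 i) (mg i))
    (measurable_mine_EFin t)).
- by move=> i x _; exact: running_min_mean_ge0.
Qed.

Lemma survivalX_ge0 t i : 0 <= (surv t ^+ i)%:E.
Proof. by rewrite lee_fin exprn_ge0// survival_ge0. Qed.

Lemma measurable_survivalX_ereal i : measurable_fun setT (fun t => (surv t ^+ i)%:E).
Proof. exact/measurable_EFinP/measurable_funX/measurable_survival. Qed.

(** The probability that all [w] waiting steps fail, that is, that the minimum of the [k.+1 + w]
    values is among the samples. *)
Lemma running_min_mean_survivalX k w :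
  running_min_mean mu k.+1 (fun t => (surv t ^+ w)%:E) +oo
  = (k.+1%:R / (k.+1 + w)%:R)%:E.
Proof.
rewrite running_min_mean_pinfty//; first last.
- exact: measurable_survivalX_ereal.
- by move=> t; exact: survivalX_ge0.
rewrite -[RHS]mule1 addSn -(integral_survivalX no_atom (k + w)).
rewrite -ge0_integralZl//; first last.
- by move=> x _; rewrite lee_fin mulr_ge0// exprn_ge0// survival_ge0.
- exact: measurable_survivalX.
apply: eq_integral => x _; rewrite -!EFinM; congr EFin.
by rewrite [RHS]mulrA divfK ?pnatr_eq0// exprD; ring.
Qed.

(* Expected future cost at threshold [t] with [w] waiting steps left, when a
   hire of cost [x] is charged [a * x + b] and running out of steps [c]. *)
Fixpoint wait_value (a b c : R) (w : nat) (t : \bar R) : \bar R :=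
  if w is w'.+1 then
    a%:E * lower_mean mu t + ((1 - surv t) * b)%:E
    + (surv t)%:E * wait_value a b c w' t
  else c%:E.

Lemma wait_value_ge0 (a b c : R) w t : (0 <= a)%R -> (0 <= b)%R -> (0 <= c)%R ->
  0 <= wait_value a b c w t.
Proof.
move=> a0 b0 c0; elim: w => [|w IH] /=; first by rewrite lee_fin.
rewrite !adde_ge0 ?mule_ge0 ?lee_fin ?survival_ge0 ?lower_mean_ge0//.
by rewrite mulr_ge0// subr_ge0 survival_le1.
Qed.

Lemma measurable_wait_value a b c w : measurable_fun setT (wait_value a b c w).
Proof.
elim: w => [|w IH] /=; first exact: measurable_cst.
have msurv := @measurable_survival R mu.
apply: emeasurable_funD; last first.
  by apply: emeasurable_funM => //; exact/measurable_EFinP.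
apply: emeasurable_funD.
  by apply: emeasurable_funM => //; exact: measurable_lower_mean.
apply/measurable_EFinP; apply: measurable_funM => //.
exact: measurable_funB.
Qed.

(** Unrolls the recursion: waiting step [i] is reached with probability [surv t ^+ i]. The mean of
    each summand over the sampled threshold is known. *)
Lemma wait_valueE (a b c : R) w t : (0 <= a)%R -> (0 <= b)%R -> (0 <= c)%R ->
  wait_value a b c w t
  = a%:E * (\sum_(i < w) lower_mean mu t * (surv t ^+ i)%:E)
    + (b%:E * (1 - surv t ^+ w)%:E + c%:E * (surv t ^+ w)%:E).
Proof.
move=> a0 b0 c0; elim: w => [|w IH] /=.
  by rewrite big_ord0 mule0 add0e expr0 subrr mule0 add0e mule1.
have S0 := survival_ge0 mu t; have S1 := survival_le1 mu t.
rewrite {}IH; move: (lower_mean mu t) (lower_mean_ge0 mu t) => h h0.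
have hS0 i : 0 <= h * (surv t ^+ i)%:E by rewrite mule_ge0// survivalX_ge0.
have sum0 : 0 <= \sum_(i < w) h * (surv t ^+ i)%:E by apply: sume_ge0.
rewrite big_ord_recl expr0 mule1 [in RHS](eq_bigr (fun i : 'I_w =>
  (surv t)%:E * (h * (surv t ^+ i)%:E))); last first.
  by move=> i _; rewrite lift0 exprS EFinM muleCA.
rewrite -[in RHS]ge0_sume_distrr//.
have bc0 : 0 <= b%:E * (1 - surv t ^+ w)%:E + c%:E * (surv t ^+ w)%:E.
  by rewrite adde_ge0// mule_ge0 ?survivalX_ge0// lee_fin subr_ge0 exprn_ile1.
rewrite ge0_muleDr ?mule_ge0// [in RHS]ge0_muleDr ?mule_ge0//.
rewrite [(surv t)%:E * (a%:E * _)]muleCA -!addeA; congr (_ + _).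
rewrite addeCA; congr (_ + _); rewrite -!EFinM -!EFinD -?EFinM -?EFinD.
by congr EFin; rewrite exprS; ring.
Qed.

Lemma mean_min_le m n : (m <= n)%N -> mean_min mu n <= mean_min mu m.
Proof.
elim: n => [|n IH]; first by rewrite leqn0 => /eqP->.
rewrite leq_eqVlt => /orP[/eqP->//|]; rewrite ltnS => /IH.
exact/le_trans/mean_min_decr.
Qed.

Lemma sum_telescope_inv (k w : nat) :
  (\sum_(i < w) (k.+1%:R / ((k.+1 + i)%:R * (k.+1 + i).+1%:R) : R))%R
  = (1 - k.+1%:R / (k.+1 + w)%:R)%R.
Proof.
elim: w => [|w IH]; first by rewrite big_ord0 addn0 divff ?subrr// pnatr_eq0.
rewrite big_ord_recr /= IH addnS -[(_ + w).+1%:R]natr1.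
have : (0 < (k.+1 + w)%:R :> R)%R by rewrite ltr0n.
move: ((k.+1 + w)%:R : R)%R => z z0.
by field; rewrite !lt0r_neq0//; lra.
Qed.

(** With three times as many waiting steps as samples, failure has probability 1/4. Each [mean_min]
    in the hiring terms is bounded by the one of least index [k.+2], which is [2 ^ j] for a phase
    with [2 ^ j - 1] samples. *)
Lemma phase_value_le k (a b c : R) : (0 <= a)%R -> (0 <= b)%R -> (0 <= c)%R ->
  running_min_mean mu k.+1 (wait_value a b c (3 * k.+1)) +oo
  <= (a * (3 / 4))%:E * mean_min mu k.+2 + (b * (3 / 4) + c * (1 / 4))%:E.
Proof.
move=> a0 b0 c0; set w := (3 * k.+1)%N.
have S1w t : 0 <= (1 - surv t ^+ w)%:E.
  by rewrite lee_fin subr_ge0 exprn_ile1// ?survival_ge0 ?survival_le1.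
have mS1w : measurable_fun setT (fun t => (1 - surv t ^+ w)%:E).
  apply/measurable_EFinP; apply: measurable_funB => //.
  exact/measurable_funX/measurable_survival.
have h0 i t : 0 <= lower_mean mu t * (surv t ^+ i)%:E.
  by rewrite mule_ge0 ?survivalX_ge0 ?lower_mean_ge0.
have mh i : measurable_fun setT (fun t => lower_mean mu t * (surv t ^+ i)%:E).
  exact: measurable_lower_meanX.
have sum0 t : 0 <= \sum_(i < w) lower_mean mu t * (surv t ^+ i)%:E.
  by apply: sume_ge0 => i _.
have msum : measurable_fun setT
    (fun t => \sum_(i < w) lower_mean mu t * (surv t ^+ i)%:E).
  exact: emeasurable_sum.
have quarter : (k.+1%:R / (k.+1 + w)%:R = 1 / 4 :> R)%R.
  rewrite (_ : (k.+1 + w)%N = (4 * k.+1)%N) ?natrM; last by rewrite /w; lia.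
  have : (0 < k.+1%:R :> R)%R by rewrite ltr0n.
  by move: (k.+1%:R : R)%R => z z0; field; rewrite !lt0r_neq0//; lra.
have -> : wait_value a b c w
  = (fun t => a%:E * (\sum_(i < w) lower_mean mu t * (surv t ^+ i)%:E))
    \+ ((fun t => b%:E * (1 - surv t ^+ w)%:E)
        \+ (fun t => c%:E * (surv t ^+ w)%:E)).
  by apply/funext => t; rewrite wait_valueE.
have b_ge0 t : 0 <= b%:E * (1 - surv t ^+ w)%:E by rewrite mule_ge0.
have c_ge0 t : 0 <= c%:E * (surv t ^+ w)%:E by rewrite mule_ge0// survivalX_ge0.
have mb : measurable_fun setT (fun t => b%:E * (1 - surv t ^+ w)%:E).
  exact: emeasurable_funM.
have mc : measurable_fun setT (fun t => c%:E * (surv t ^+ w)%:E).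
  by apply: emeasurable_funM => //; exact: measurable_survivalX_ereal.
rewrite running_min_meanD; first last.
- exact: emeasurable_funD.
- by move=> t; rewrite adde_ge0.
- exact: emeasurable_funM.
- by move=> t; rewrite mule_ge0.
rewrite running_min_meanD// !running_min_meanZ//; first last.
- exact: measurable_survivalX_ereal.
- by move=> t; exact: survivalX_ge0.
rewrite (@running_min_mean_sum k.+1 w
  (fun i t => lower_mean mu t * (surv t ^+ i)%:E) h0 mh).
rewrite running_min_mean_survivalX quarter.
have -> : running_min_mean mu k.+1 (fun t => (1 - surv t ^+ w)%:E) +oo = (3 / 4)%:E.
  have e : running_min_mean mu k.+1 (fun t => (1 - surv t ^+ w)%:E) +oo
         + (1 / 4)%:E = 1.
    rewrite -quarter -running_min_mean_survivalX -running_min_meanD//; first last.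
    - exact: measurable_survivalX_ereal.
    - by move=> t; exact: survivalX_ge0.
    rewrite -(running_min_mean_cst1 mu k.+1 +oo); congr running_min_mean.
    by apply/funext => t /=; rewrite -EFinD subrK.
  have := congr1 (fun z => z - (1 / 4)%:E) e; rewrite addeK// => ->.
  by rewrite -EFinB; congr EFin; lra.
rewrite -!EFinM -EFinD EFinM -muleA; apply: leeD => //.
apply: lee_pmul => //.
  by apply: sume_ge0 => i _; exact: running_min_mean_ge0.
rewrite (_ : 3 / 4 = \sum_(i < w) (k.+1%:R / ((k.+1 + i)%:R * (k.+1 + i).+1%:R))
   :> R)%R; last by rewrite sum_telescope_inv quarter; lra.
rewrite -sumEFin ge0_sume_distrl; last first.
  by move=> i _; rewrite lee_fin divr_ge0.
apply: lee_sum => i _; rewrite running_min_mean_lower_mean//.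
apply: lee_pmul; rewrite ?lee_fin ?divr_ge0//; first exact: mean_min_ge0.
by apply: mean_min_le; rewrite addSn !ltnS leq_addr.
Qed.

End phase_value.

Lemma le_of_eq (d : Order.disp_t) (T : porderType d) (x y : T) :
  x = y -> (x <= y)%O.
Proof. by move=> ->. Qed.

(** * The potential of the phase walk *)

Section potential.
Context (R : realType) (mu : probability R R).
Hypothesis no_atom : forall r, mu [set r] = 0%E.
Hypothesis finite_mean : (mean_min mu 1 < +oo)%E.

Definition mean_minr (s : nat) : R := fine (mean_min mu s).

Lemma mean_minrE s : (0 < s)%N -> (mean_minr s)%:E = mean_min mu s.
Proof.
move=> s0; rewrite fineK// ge0_fin_numE ?mean_min_ge0//.
exact: le_lt_trans (mean_min_le mu s0) finite_mean.
Qed.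

Lemma mean_minr_ge0 s : 0 <= mean_minr s.
Proof. exact/fine_ge0/mean_min_ge0. Qed.

Lemma mean_minr_le m n : (0 < m)%N -> (m <= n)%N -> mean_minr n <= mean_minr m.
Proof.
move=> m0 mn; rewrite -lee_fin !mean_minrE ?mean_min_le//.
exact: leq_trans mn.
Qed.

(** The contract length in phase [l] times the bound on the mean cost of a hire there. *)
Definition hire_charge (l : nat) : R := 16 * 2 ^+ l * mean_minr (2 ^ l).

Lemma hire_charge_ge0 l : 0 <= hire_charge l.
Proof. by rewrite !mulr_ge0// ?exprn_ge0// mean_minr_ge0. Qed.

(* The phase performs a random walk with up-probability 3/4, reflected at 0;
   started in phase [j] it makes on average [3/2 * (1/3) ^ (j - l)] successful
   visits to phase [l], where [j - l] is truncated. *)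
Definition potential (L j : nat) : R :=
  \sum_(l < L) 3 / 2 * (1 / 3) ^+ (j - l) * hire_charge l.

Lemma potential_ge0 L j : 0 <= potential L j.
Proof.
apply: sumr_ge0 => l _; apply: mulr_ge0; last exact: hire_charge_ge0.
by rewrite !mulr_ge0// ?exprn_ge0// divr_ge0.
Qed.

Lemma sum_hire_charge L j : (j < L)%N ->
  \sum_(l < L) (l == j :> nat)%:R * hire_charge l = hire_charge j.
Proof.
move=> jL; rewrite (bigD1 (Ordinal jL))//= eqxx mul1r big1 ?addr0// => l lj.
by rewrite (_ : (l == j :> nat) = false) ?mul0r//; apply/negbTE: lj.
Qed.

(** Phase 0 always hires and moves up. Only the coefficient of level 0 differs:
    [3 / 2 = 1 + 1 / 2]. *)
Lemma potential0 L : (0 < L)%N ->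
  potential L 0 = hire_charge 0 + potential L 1.
Proof.
move=> L0; rewrite -(sum_hire_charge L0) -big_split /=.
apply: eq_bigr => -[[|l] lL] _ /=; first by rewrite mul1r expr0 expr1; lra.
by rewrite !sub0n subSS sub0n mul0r add0r.
Qed.

(** The one-step equation of the walk. Along [j], the coefficient of a fixed level is geometric,
    with ratio 1/3 past that level and 1 before it, the two roots of [r = 3/4 * r^2 + 1/4]; at level
    [j.+1] the hire charge makes up the difference. *)
Lemma potentialS L j : (j.+1 < L)%N ->
  potential L j.+1 = 3 / 4 * hire_charge j.+1
    + 3 / 4 * potential L j.+2 + 1 / 4 * potential L j.
Proof.
move=> jL; rewrite -[in RHS](sum_hire_charge jL) !mulr_sumr -!big_split /=.
apply: eq_bigr => l _; set h := hire_charge _.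
case: (ltngtP l j.+1) => [lj|jl|lj] /=.
- have -> : (j.+1 - l = (j - l).+1)%N by lia.
  have -> : (j.+2 - l = (j - l).+2)%N by lia.
  by rewrite !exprS; set y := _ ^+ (j - l); field.
- have -> : (j.+1 - l = 0)%N by lia.
  have -> : (j.+2 - l = 0)%N by lia.
  have -> : (j - l = 0)%N by lia.
  by rewrite !expr0; field.
- rewrite lj subnn subSnn (_ : (j - j.+1 = 0)%N); last by lia.
  by rewrite expr0 expr1; field.
Qed.

(** Cauchy condensation: each new term is at most twice the block of the [2 ^ L] indices that end at
    [2 ^ L.+1], since [mean_minr] is nonincreasing. *)
Lemma sum_hire_charge_le L :
  \sum_(l < L.+1) 2 ^+ l * mean_minr (2 ^ l)
  <= 2 * \sum_(s < 2 ^ L) mean_minr s.+1.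
Proof.
elim: L => [|L IH].
  rewrite !big_ord1 expr0 mul1r /=.
  by have := mean_minr_ge0 1; lra.
rewrite big_ord_recr /= expnS mul2n -addnn big_split_ord /= mulrDr.
apply: lerD => //; rewrite addnn -mul2n -expnS exprS -mulrA ler_pM2l//.
rewrite -natrX mulr_natl -[X in _ *+ X]card_ord -sumr_const.
apply: ler_sum => s _; apply: mean_minr_le => //.
rewrite expnS; have := ltn_ord s; lia.
Qed.

(** In phase 0 every level has coefficient 3/2, which with the contract factor 16 gives 24;
    condensation doubles this. *)
Lemma potential0_le n : (0 < n)%N ->
  potential (trunc_log 2 n).+1 0 <= 48 * \sum_(s < n) mean_minr s.+1.
Proof.
move=> n0; have Ln := trunc_logP (isT : 1 < 2)%N n0.
rewrite (_ : potential _ 0 = 24 * \sum_(l < (trunc_log 2 n).+1)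
    2 ^+ l * mean_minr (2 ^ l)); last first.
  rewrite mulr_sumr; apply: eq_bigr => l _; rewrite sub0n expr0 /hire_charge.
  by set y := _ ^+ _; set z := mean_minr _; field.
have := sum_hire_charge_le (trunc_log 2 n).
have : \sum_(s < 2 ^ trunc_log 2 n) mean_minr s.+1
       <= \sum_(s < n) mean_minr s.+1.
  rewrite -!(big_mkord xpredT (fun s => mean_minr s.+1)).
  rewrite [leRHS](big_cat_nat (n := 2 ^ trunc_log 2 n))//= lerDl.
  by apply: sumr_ge0 => s _; exact: mean_minr_ge0.
lra.
Qed.

Context (n : nat).
Local Notation pot := (potential (trunc_log 2 n).+1).
Local Open Scope ereal_scope.

(** A hire is charged its contract plus the potential of phase [j.+1]; running out of waiting steps
    is charged the potential of phase [j.-1]. *)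
Definition state_value (s : sw_state R) : \bar R :=
  let: SWState tau ts tw j stopped := s in
  if stopped then 0 else
  running_min_mean mu ts
    (wait_value mu (16 * 2 ^+ j) (pot j.+1) (pot j.-1) tw) tau.

Lemma contract_ge0 j : (0 <= 16 * 2 ^+ j :> R)%R.
Proof. by rewrite mulr_ge0// exprn_ge0. Qed.

Lemma phase_wait_value_ge0 j w t :
  0 <= wait_value mu (16 * 2 ^+ j) (pot j.+1) (pot j.-1) w t.
Proof. by rewrite wait_value_ge0 ?contract_ge0 ?potential_ge0. Qed.

Lemma state_value_ge0 s : 0 <= state_value s.
Proof.
case: s => tau ts tw j [] //=.
by apply: running_min_mean_ge0 => t; exact: phase_wait_value_ge0.
Qed.

Lemma state_value_start j : (2 ^ j <= n)%N ->
  state_value (sw_start R 3 j) <= (pot j)%:E.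
Proof.
move=> jn; have jL : (j < (trunc_log 2 n).+1)%N.
  by rewrite ltnS; exact: trunc_log_max.
case: j jn jL => [|j] jn jL.
  (* At threshold [+oo], [survival] is 0, which removes the fictitious descent from phase 0, and
     [lower_mean] equals [mean_min 1]. *)
  rewrite /= survival_pinfty mul0e adde0 subr0 mul1r potential0// EFinD.
  apply: leeD => //; rewrite /hire_charge [leRHS]EFinM mean_minrE//.
  apply: lee_pmul; rewrite ?lower_mean_ge0 ?lee_fin ?contract_ge0//.
  rewrite expn0 mean_minE//; apply: le_of_eq; apply: eq_integral => x _.
  by rewrite leey expr0 mulr1 mule1.
rewrite /=.
have [k hk] : exists k, (2 ^ j.+1 = k.+2)%N.
  exists (2 ^ j.+1 - 2)%N.
  by have := expn_gt0 2 j; rewrite expnS; lia.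
rewrite hk subn1 [k.+2.-1]/= (_ : maxn 1 (3 * k.+1) = (3 * k.+1)%N); last by lia.
apply: le_trans (phase_value_le no_atom _ _ _ _) _.
- exact: contract_ge0.
- exact: potential_ge0.
- exact: potential_ge0.
rewrite [in leRHS]potentialS// /hire_charge hk -mean_minrE// -EFinM -EFinD lee_fin /=.
by apply: le_of_eq; ring.
Qed.

(** The supermartingale inequality. A sampling step peels off one integral, a waiting step one layer
    of [wait_value], and entering a phase is paid for by [state_value_start]. *)
Lemma state_value_step i (s : sw_state R) : (2 ^ sw_phase s <= n)%N ->
  \int[mu]_x (((sw_step 3 n i x s).2%:R)%:E * pos_part x%:E
              + state_value (sw_step 3 n i x s).1) <= state_value s.
Proof.
case: s => tau ts tw j [] /= jn.
  by rewrite integral0_eq// => x _; rewrite mul0e adde0.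
case: ts => [|ts] /=; last first.
  apply: le_of_eq; apply: eq_integral => x _.
  by rewrite mul0e add0e subn1.
case: tw => [|w] /=; last first.
  pose t := ((1 + 3) * 2 ^ (j + 2))%N.
  have tE : (t%:R = 16 * 2 ^+ j :> R)%R.
    rewrite (_ : t = (16 * 2 ^ j)%N) ?natrM ?natrX//.
    by rewrite /t expnD; lia.
  pose v := wait_value mu (16 * 2 ^+ j) (pot j.+1) (pot j.-1) w tau.
  have v0 : 0 <= v by exact: phase_wait_value_ge0.
  have p0 : 0 <= (pot j.+1)%:E by rewrite lee_fin potential_ge0.
  (* Cost of a hire, potential after it, and value after a rejection. *)
  pose f1 x := if x%:E <= tau then t%:R%:E * pos_part x%:E else 0.
  pose f2 x := if x%:E <= tau then (pot j.+1)%:E else 0.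
  pose f3 x := if tau < x%:E then v else 0.
  have t0 : 0 <= t%:R%:E :> \bar R by rewrite lee_fin.
  have f10 x : 0 <= f1 x.
    by rewrite /f1; case: ifP => // _; rewrite mule_ge0// pos_part_ge0.
  have f20 x : 0 <= f2 x by rewrite /f2; case: ifP.
  have f30 x : 0 <= f3 x by rewrite /f3; case: ifP.
  have mle : measurable_fun setT (fun x : R => x%:E <= tau).
    by apply: measurable_fun_lee => //; exact: EFin_measurable.
  have mlt : measurable_fun setT (fun x : R => tau < x%:E).
    by apply: measurable_fun_lte => //; exact: EFin_measurable.
  have mf1 : measurable_fun setT f1.
    apply: measurable_fun_ifT => //; apply: emeasurable_funM => //.
    exact: measurable_pos_part_EFin.
  have mf2 : measurable_fun setT f2 by exact: measurable_fun_ifT.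
  have mf3 : measurable_fun setT f3 by exact: measurable_fun_ifT.
  apply: (@le_trans _ _ (\int[mu]_x (f1 x + f2 x + f3 x))).
    apply: ge0_le_integral_nonmeasurable => x.
      by rewrite adde_ge0 ?state_value_ge0// mule_ge0 ?pos_part_ge0.
    rewrite /f1 /f2 /f3 ltNge; case: ifPn => xtau /=; last first.
      by rewrite mul0e subn1 !add0e.
    rewrite adde0 -/t; case: ifPn => stop /=.
      by rewrite leeD.
    rewrite leeD2l// addn1 state_value_start//.
    (* The contract ends within the horizon here, so [2 ^ j.+1 <= t <= n]. *)
    apply: leq_trans (_ : t <= n)%N; last by lia.
    by rewrite /t expnD expnS; lia.
  rewrite ge0_integralD//; first last.
  - exact: emeasurable_funD.
  - by move=> x _; rewrite adde_ge0.
  rewrite ge0_integralD// integral_survival// [v * _]muleC.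
  apply: leeD => //; apply: leeD.
    rewrite /lower_mean -ge0_integralZl ?lee_fin ?contract_ge0//; first last.
    - by move=> x _; case: ifP => // _; exact: pos_part_ge0.
    - by apply: measurable_fun_ifT => //; exact: measurable_pos_part_EFin.
    apply: le_of_eq; apply: eq_integral => x _; rewrite /f1 tE.
    by case: ifP => // _; rewrite mule0.
  have e : \int[mu]_x f2 x + (pot j.+1)%:E * (survival mu tau)%:E = (pot j.+1)%:E.
    rewrite -integral_survival// -ge0_integralD//; first last.
    - exact: measurable_fun_ifT.
    - by move=> x _; case: ifP.
    rewrite -[RHS]mule1 -(@probability_setT _ _ _ mu) -integral_cst//.
    apply: eq_integral => x _; rewrite /f2 ltNge.
    by case: ifP; rewrite ?adde0 ?add0e.
  have := congr1 (fun z => z - (pot j.+1)%:E * (survival mu tau)%:E) e.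
  rewrite -EFinM addeK// => ->; rewrite -EFinB lee_fin.
  by apply: le_of_eq; ring.
have -> : \int[mu]_x (0%:R%:E * pos_part x%:E + state_value (sw_start R 3 (j - 1)))
        = state_value (sw_start R 3 j.-1).
  rewrite (eq_integral (cst (state_value (sw_start R 3 j.-1)))); last first.
    by move=> x _; rewrite mul0e add0e subn1.
  rewrite integral_cst// -[RHS]mule1; congr (_ * _).
  exact: probability_setT.
apply: state_value_start; apply: leq_trans jn.
by rewrite leq_exp2l// leq_pred.
Qed.

End potential.

(** * Processes driven by independent samples *)

Section driven_process.
Context (R : realType) (mu : probability R R) (d : measure_display)
  (T : measurableType d) (P : probability T R) (X : nat -> {RV P >-> R}).
Hypothesis iidX : iid mu X.
Context (dS : measure_display) (S : measurableType dS) (s0 : S)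
  (step : nat -> S * R -> S).
Hypothesis mstep : forall k, measurable_fun setT (step k).
Local Open Scope ereal_scope.

Fixpoint process (k : nat) (w : T) : S :=
  if k is k'.+1 then step k' (process k' w, X k' w) else s0.

Lemma measurable_process_pair k : measurable_fun setT (process k) ->
  measurable_fun setT (fun w => (process k w, X k w)).
Proof.
by move=> mp; apply: measurable_fun_pair => //; exact: measurable_funPT.
Qed.

Lemma measurable_process k : measurable_fun setT (process k).
Proof.
elim: k => [|k IH]; first exact: measurable_cst.
exact: (measurableT_comp (mstep k) (measurable_process_pair IH)).
Qed.

Definition process_mfun k : {mfun T >-> S} := mfun_Sub (mem_set (measurable_process k)).

Definition process_law k := distribution P (process_mfun k).

Lemma process_lawE k A : process_law k A = P (process k @^-1` A).
Proof. by []. Qed.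

Definition cylinder (J : {fset nat}) (B : nat -> set R) : set T :=
  \bigcap_(i in [set` J]) (X i @^-1` B i).

Lemma measurable_cylinder J B : (forall i, measurable (B i)) ->
  measurable (cylinder J B).
Proof.
move=> mB; apply: fin_bigcap_measurable; first exact: finite_fset.
by move=> i _; exact: measurable_funPTI.
Qed.

Lemma probability_cylinder J B : (forall i, measurable (B i)) ->
  P (cylinder J B) = \prod_(i <- J) mu (B i).
Proof.
move=> mB; have [indep same_law] := iidX; rewrite indep//.
by apply: eq_bigr => i _; rewrite -(same_law i).
Qed.

Lemma cylinderU1 k J B A : k \notin J ->
  cylinder (k |` J)%fset (fun i => if i == k then A else B i)
  = X k @^-1` A `&` cylinder J B.
Proof.
move=> kJ; rewrite /cylinder bigcap_fsetU1 eqxx; congr (_ `&` _).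
apply: eq_bigcapr => i /= iJ; case: eqP => // ik.
by rewrite -ik iJ in kJ.
Qed.

Lemma probability_cylinderU1 k J B A : k \notin J -> measurable A ->
  (forall i, measurable (B i)) ->
  P (X k @^-1` A `&` cylinder J B) = mu A * P (cylinder J B).
Proof.
move=> kJ mA mB; rewrite -cylinderU1// !probability_cylinder//; last first.
  by move=> i; case: ifP.
rewrite big_fsetU1//= eqxx; congr (_ * _).
apply: eq_big_seq => i iJ /=; case: eqP => // ik.
by rewrite -ik iJ in kJ.
Qed.

(** All cylinders over later samples are carried along so that the induction on [k] goes through. *)
Definition past_indep k := forall (J : {fset nat}) (B : nat -> set R) A,
  (forall i, measurable (B i)) -> (forall i, i \in J -> (k <= i)%N) ->
  measurable A ->
  P (process k @^-1` A `&` cylinder J B) = process_law k A * P (cylinder J B).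

(** Conditioned on the cylinder, the law of the pair agrees with the product measure on rectangles,
    hence everywhere. On a rectangle, the event on [X k] is absorbed into the cylinder. *)
Lemma pair_indep k : past_indep k -> forall (J : {fset nat}) (B : nat -> set R) C,
  (forall i, measurable (B i)) -> (forall i, i \in J -> (k < i)%N) ->
  measurable C ->
  P ((fun w => (process k w, X k w)) @^-1` C `&` cylinder J B)
  = (process_law k \x mu) C * P (cylinder J B).
Proof.
move=> indep J B C mB hJ mC; have mE := measurable_cylinder J mB.
have mpair := measurable_process_pair (measurable_process k).
have mpairC D : measurable D ->
    measurable ((fun w => (process k w, X k w)) @^-1` D).
  by move=> mD; rewrite -[X in measurable X]setTI; exact: mpair.
(* A null cylinder cannot be conditioned on, but then both sides are 0. *)
have [PE0|PE0] := eqVneq (P (cylinder J B)) 0.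
  rewrite PE0 mule0; apply/eqP; rewrite -measure_le0 -PE0.
  apply: le_measure; [|by rewrite inE|exact: subIsetr].
  rewrite inE.
  by apply: measurableI => //; exact: mpairC.
pose p := fine (P (cylinder J B)).
have pE : P (cylinder J B) = p%:E by rewrite fineK// fin_num_measure.
have p0 : p != 0%R by move: PE0; rewrite pE eqe.
have pge0 : (0 <= p^-1)%R by rewrite invr_ge0 -lee_fin -pE.
pose m' : {measure set (S * R) -> \bar R} := mscale (NngNum pge0)
  (measure_function_pushforward__canonical__measure_function_Measure
    (mrestr P mE) mpair).
have m'E D : m' D = p^-1%:E * P ((fun w => (process k w, X k w)) @^-1` D
    `&` cylinder J B) by [].
rewrite (@product_measure_unique _ _ _ _ _ (process_law k) mu m') ?m'E//.
  by rewrite muleAC pE -EFinM mulVf// mul1e.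
move=> A1 A2 mA1 mA2; rewrite m'E.
have -> : (fun w => (process k w, X k w)) @^-1` (A1 `*` A2) `&` cylinder J B
   = process k @^-1` A1 `&` (X k @^-1` A2 `&` cylinder J B).
  by apply/seteqP; split => [w [[? ?] ?]|w [? [? ?]]]; do ?split.
have kJ : k \notin J by apply/negP => /hJ; rewrite ltnn.
rewrite -cylinderU1// indep//; last 2 first.
- by move=> i; case: ifP.
- by move=> i; rewrite in_fset1U => /orP[/eqP->//|/hJ/ltnW].
rewrite cylinderU1// probability_cylinderU1// pE.
rewrite muleCA; congr (_ * _).
by rewrite muleCA -EFinM mulVf// mule1.
Qed.

(** The start is constant, so its events are trivial. An event at [k.+1] is one on the pair at [k],
    and the empty cylinder identifies its product mass with [process_law k.+1]. *)
Lemma process_indep k : past_indep k.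
Proof.
elim: k => [|k IH] J B A mB hJ mA.
  rewrite process_lawE /=.
  have [As0|As0] := pselect (A s0).
    rewrite (_ : _ @^-1` A = setT) ?setTI; last first.
      by apply/seteqP; split.
    by rewrite probability_setT mul1e.
  rewrite (_ : _ @^-1` A = set0) ?set0I ?measure0 ?mul0e//.
  by apply/seteqP; split.
have mC : measurable (step k @^-1` A).
  by rewrite -[X in measurable X]setTI; exact: mstep.
transitivity ((process_law k \x mu) (step k @^-1` A) * P (cylinder J B)).
  exact: (pair_indep IH mB hJ mC).
congr (_ * _); apply/esym.
have h0 i : i \in (fset0 : {fset nat}) -> (k < i)%N by [].
have := pair_indep IH mB h0 mC.
rewrite (_ : cylinder fset0 B = setT) ?setIT ?probability_setT ?mule1; last first.
  by rewrite /cylinder set_fset0 bigcap_set0.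
exact.
Qed.

(** The sample is independent of the state, so their joint law is a product and Tonelli applies. *)
Lemma expectation_process k (f : S * R -> \bar R) : measurable_fun setT f ->
  (forall z, 0 <= f z) ->
  \int[P]_w f (process k w, X k w)
  = \int[P]_w \int[mu]_x f (process k w, x).
Proof.
move=> mf f0.
have mpair := measurable_process_pair (measurable_process k).
pose pm := measure_function_pushforward__canonical__measure_function_Measure P mpair.
have pmE C : measurable C -> pm C = (process_law k \x mu) C.
  move=> mC; have h0 i : i \in (fset0 : {fset nat}) -> (k < i)%N by [].
  have := pair_indep (@process_indep k) (fun=> measurableT) h0 mC.
  rewrite (_ : cylinder fset0 _ = setT) ?setIT ?probability_setT ?mule1//.
  by rewrite /cylinder set_fset0 bigcap_set0.
transitivity (\int[pm]_z f z).
  by rewrite ge0_integral_pushforward// preimage_setT.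
rewrite (eq_measure_integral (process_law k \x mu)); last first.
  by move=> C mC _; exact: pmE.
rewrite fubini_tonelli1//.
have mF : measurable_fun setT (fubini_F mu f) by exact: measurable_fun_fubini_tonelli_F.
rewrite (ge0_integral_pushforward (measurable_process k))//.
by move=> s _; apply: integral_ge0.
Qed.

End driven_process.

(** * The offline optimum *)

(** For [s < r] the mass of []-oo, s]] is at most that of []-oo, r[]; let [s] tend to [r] from the
    left. *)
Lemma continuous_cdf_no_atom (R : realType) (mu : probability R R) :
  continuous (fun r : R => mu `]-oo, r]%classic) -> forall r, mu [set r] = 0%E.
Proof.
move=> cmu r.
have splitr : (mu `]-oo, r[%classic + mu [set r] = mu `]-oo, r]%classic)%E.
  rewrite -measureU//; first by rewrite setUitv1.
  apply/seteqP; split => x //= -[]; rewrite in_itv /= => xr xE.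
  by rewrite xE ltxx in xr.
have le_lt : (mu `]-oo, r]%classic <= mu `]-oo, r[%classic)%E.
  apply: (@cvge_le _ r^'- _ _ (fun s => mu `]-oo, s]%classic)); last first.
    exact/cvg_at_left_filter/cmu.
  near=> s; apply: le_measure; rewrite ?inE//.
  apply: subset_itvl; rewrite bnd_simp.
  by near: s; exact: nbhs_left_lt.
apply/eqP; rewrite -measure_le0.
have fin : mu `]-oo, r[%classic \is a fin_num by exact: fin_num_measure.
by rewrite -(leeD2lE _ _ fin) splitr adde0.
Unshelve. all: by end_near. Qed.

Section offline_optimum.
Context (R : realType).
Implicit Types (n : nat) (x : nat -> R).

Lemma sum_interval_le n i t : (\sum_(s < n) (i <= s < i + t) <= t)%N.
Proof.
suff -> : (\sum_(s < n) (i <= s < i + t) = minn n (i + t) - minn n i)%N by lia.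
elim: n => [|n IH]; first by rewrite big_ord0; lia.
by rewrite big_ord_recr /= IH; case: (leqP i n); case: (ltnP n (i + t)) => /=; lia.
Qed.

(** Each time step [s] charges [m s] to an applicant who covers it, and applicant [i] is charged at
    most [t i] times. *)
Lemma hiring_cost_ge_sum n x (t : nat -> nat) (m : nat -> R) :
  (forall i, (i < n)%N -> 0 <= x i) ->
  (forall s i, (i <= s < n)%N -> m s <= x i) -> feasible n t ->
  \sum_(s < n) m s <= hiring_cost n t x.
Proof.
move=> x0 mx ft.
apply: (@le_trans _ _ (\sum_(s < n) \sum_(i < n) (i <= s < i + t i)%:R * x i)).
  apply: ler_sum => s _; have [i /andP[lis sit]] := ft s (ltn_ord s).
  have ltin : (i < n)%N by apply: leq_ltn_trans (ltn_ord s).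
  rewrite (bigD1 (Ordinal ltin))//= lis sit mul1r ler_wpDr ?mx ?lis ?ltn_ord//.
  by apply: sumr_ge0 => k _; rewrite mulr_ge0// x0.
rewrite exchange_big /=; apply: ler_sum => i _.
rewrite -mulr_suml ler_wpM2r ?x0//.
by rewrite -natr_sum ler_nat sum_interval_le.
Qed.

Lemma feasible_ge1 n (t : nat -> nat) : (forall i, 0 < t i)%N -> feasible n t.
Proof. by move=> t0 s _; exists s; have := t0 s; lia. Qed.

Lemma opt_ge_sum n x (m : nat -> R) : (forall i, (i < n)%N -> 0 <= x i) ->
  (forall s i, (i <= s < n)%N -> m s <= x i) -> \sum_(s < n) m s <= opt n x.
Proof.
move=> x0 mx; apply: lb_le_inf.
  by exists (hiring_cost n (fun=> 1%N) x); exists (fun=> 1%N) => //; exact: feasible_ge1.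
by move=> _ [t ft <-]; exact: hiring_cost_ge_sum.
Qed.

(* With a negative cost the hiring costs are unbounded below, and the infimum
   of an unbounded set is 0 by convention. *)
Lemma opt_ge0 n x : 0 <= opt n x.
Proof.
have [x0|/existsNP[i /not_implyP[lin /negP]]] :=
    pselect (forall i, (i < n)%N -> 0 <= x i).
  rewrite (_ : 0 = \sum_(s < n) 0); last by rewrite big1.
  by apply: (opt_ge_sum (m := fun=> 0)) => // s k /andP[ks sn]; exact/x0/(leq_ltn_trans ks sn).
rewrite -ltNge => xi_lt0; rewrite /opt inf_out// => -[_ [c lb_c]].
(* Extending the contract of negative cost by [m] steps pushes the total below the supposed lower
   bound [c]. *)
pose m := Num.bound `|(\sum_(k < n) x k - c) / - x i|.
pose t k := (1 + (k == i) * m)%N.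
have ft : feasible n t by apply: feasible_ge1 => k; rewrite /t; lia.
have /lb_c : [set hiring_cost n u x | u in feasible n] (hiring_cost n t x).
  by exists t.
rewrite leNgt => /negP; apply.
rewrite /hiring_cost (eq_bigr (fun k : 'I_n => x k + (k == i :> nat)%:R * m%:R * x k)).
  rewrite big_split /= [X in _ + X](bigD1 (Ordinal lin))//= eqxx mul1r.
  rewrite [X in _ + (_ + X)]big1 ?addr0 => [|k ki]; last first.
    by rewrite (_ : (k == i :> nat) = false) ?mul0r//; apply/negbTE: ki.
  have := le_lt_trans (ler_norm _) (archi_boundP (normr_ge0
    ((\sum_(k < n) x k - c) / - x i))).
  rewrite ltr_pdivrMr ?oppr_gt0// -/m; lra.
by move=> k _; rewrite /t natrD natrM mulrDl mul1r.
Qed.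
End offline_optimum.

(** * The competitive ratio *)

Section countable_cases.
Context (d1 d2 : measure_display) (D : measurableType d1) (C : measurableType d2).

Lemma measurable_fun_nat_cases (kappa : D -> nat) (F : nat -> D -> C) :
  measurable_fun setT kappa -> (forall m, measurable_fun setT (F m)) ->
  measurable_fun setT (fun z => F (kappa z) z).
Proof.
move=> mk mF _ Y mY; rewrite setTI.
rewrite (_ : _ @^-1` Y = \bigcup_m (kappa @^-1` [set m] `&` F m @^-1` Y)).
  apply: bigcupT_measurable => m; apply: measurableI.
    by rewrite -[X in measurable X]setTI; exact: mk.
  by rewrite -[X in measurable X]setTI; exact: mF.
apply/seteqP; split => [z /= Yz|z [m _ [/= <-]]//].
by exists (kappa z).
Qed.
End countable_cases.

(** * Measurability of the encoded algorithm *)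

Section state_encoding.
Context (R : realType).

(* [\bar R * nat] carries a measurable structure, which [sw_state] does not. *)
Definition state_code (s : sw_state R) : \bar R * nat :=
  (sw_tau s, choice.pickle (sw_sample s, sw_wait s, sw_phase s, sw_stopped s)).

Definition state_decode (p : \bar R * nat) : sw_state R :=
  if choice.unpickle p.2 is Some (ts, tw, j, b) then SWState p.1 ts tw j b
  else SWState p.1 0 0 0 true.

Lemma state_codeK : cancel state_code state_decode.
Proof. by case=> tau ts tw j b; rewrite /state_decode /state_code /= choice.pickleK. Qed.

Variable n : nat.

Definition coded_step (k : nat) (z : (\bar R * nat) * R) : \bar R * nat :=
  state_code (sw_step 3 n k.+1 z.2 (state_decode z.1)).1.

Definition coded_cost (k : nat) (z : (\bar R * nat) * R) : \bar R :=
  ((sw_step 3 n k.+1 z.2 (state_decode z.1)).2%:R%:E * pos_part z.2%:E)%E.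

Local Notation dom := ((\bar R * nat) * R)%type.

Lemma measurable_state_tau : measurable_fun setT (fun z : dom => z.1.1).
Proof. exact: measurableT_comp. Qed.

Lemma measurable_state_nat : measurable_fun setT (fun z : dom => z.1.2).
Proof. exact: measurableT_comp. Qed.

Lemma measurable_cost_EFin : measurable_fun setT (fun z : dom => z.2%:E).
Proof. exact/measurable_EFinP. Qed.

(** Once the discrete part is fixed, a step involves at most one comparison of the cost with the
    threshold. An arbitrary [F] serves both the next state and the cost. *)
Lemma measurable_sw_step (d : measure_display) (C : measurableType d)
    (F : sw_state R * nat -> R -> C) (k : nat) :
  (forall ts tw j b t,
    measurable_fun setT (fun z : \bar R * R => F (SWState z.1 ts tw j b, t) z.2)) ->
  measurable_fun setT
    (fun z : dom => F (sw_step 3 n k.+1 z.2 (state_decode z.1)) z.2).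
Proof.
move=> mF.
have mF' (f : dom -> \bar R) ts tw j b t : measurable_fun setT f ->
    measurable_fun setT (fun z : dom => F (SWState (f z) ts tw j b, t) z.2).
  move=> mf; have mfx : measurable_fun setT (fun z : dom => (f z, z.2)).
    exact: measurable_fun_pair.
  exact: (measurableT_comp (mF ts tw j b t) mfx).
have mtau := measurable_state_tau.
pose G m (z : dom) :=
  F (sw_step 3 n k.+1 z.2 (state_decode (z.1.1, m))) z.2.
suff mG m : measurable_fun setT (G m).
  have -> : (fun z : dom => F (sw_step 3 n k.+1 z.2 (state_decode z.1)) z.2)
          = fun z => G z.1.2 z by apply/funext => -[[tau m] x].
  exact: (measurable_fun_nat_cases measurable_state_nat).
rewrite {}/G /state_decode /=.
case: (choice.unpickle m) => [[[[ts tw] j] b]|] /=; last exact: mF'.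
case: b => /=; first exact: mF'.
case: (0 < ts)%N.
  by apply: mF'; apply: measurable_mine => //; exact: measurable_cost_EFin.
case: (0 < tw)%N; last exact: mF'.
rewrite (_ : (fun z => _) = fun z : dom => if (z.2%:E <= z.1.1)%E
    then F (if (n < k.+1 + (1 + 3) * 2 ^ (j + 2))%N
            then (SWState z.1.1 ts (tw - 1) j true, ((1 + 3) * 2 ^ (j + 2))%N)
            else (sw_start R 3 (j + 1), ((1 + 3) * 2 ^ (j + 2))%N)) z.2
    else F (SWState z.1.1 ts (tw - 1) j false, 0%N) z.2); last first.
  by apply/funext => z; case: ifP.
apply: measurable_fun_ifT; last exact: mF'.
  by apply: measurable_fun_lee => //; exact: measurable_cost_EFin.
by case: (_ < _)%N; exact: mF'.
Qed.

Lemma measurable_coded_step k : measurable_fun setT (coded_step k).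
Proof.
apply: (measurable_sw_step (F := fun r _ => state_code r.1)) => ts tw j b t.
apply: measurable_fun_pair => /=; first exact: measurable_fst.
exact: measurable_cst.
Qed.

Lemma measurable_coded_cost k : measurable_fun setT (coded_cost k).
Proof.
apply: (measurable_sw_step (F := fun r x => (r.2%:R%:E * pos_part x%:E)%E)).
move=> ts tw j b t /=; apply: emeasurable_funM => //.
apply: (measurableT_comp (@measurable_pos_part R)).
exact/measurable_EFinP.
Qed.

Lemma coded_cost_ge0 k z : (0 <= coded_cost k z)%E.
Proof. by rewrite mule_ge0 ?pos_part_ge0// lee_fin. Qed.

Lemma measurable_state_value (mu : probability R R) :
  measurable_fun setT (fun p => state_value mu n (state_decode p)).
Proof.
pose G m (p : \bar R * nat) := state_value mu n (state_decode (p.1, m)).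
have -> : (fun p => state_value mu n (state_decode p)) = fun p => G p.2 p.
  by apply/funext => -[].
apply: (measurable_fun_nat_cases measurable_snd) => m.
rewrite /G /state_decode /=.
case: (choice.unpickle m) => [[[[ts tw] j] []]|] /=; try exact: measurable_cst.
apply: (measurableT_comp (measurable_running_min_mean _ _ _ _) measurable_fst).
  by move=> t; exact: phase_wait_value_ge0.
exact: measurable_wait_value.
Qed.
End state_encoding.

(** * Comparison of the two expectations *)

Section competitive_ratio.
Context (R : realType) (mu : probability R R).
Hypothesis no_atom : forall r, mu [set r] = 0%E.
Hypothesis mu_nonpos : mu `]-oo, 0]%classic = 0%E.
Context (d : measure_display) (T : measurableType d) (P : probability T R)
  (X : nat -> {RV P >-> R}).
Hypothesis iidX : iid mu X.
Context (n : nat).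
Hypothesis n_gt0 : (0 < n)%N.
Local Open Scope ereal_scope.
Local Notation A := (sample_wait_algorithm R 3).
Local Notation costs w := (fun i => X i w).

Let coded_run := process X (state_code (oinit A)) (coded_step n).

Lemma coded_runE k w : coded_run k w = state_code (state_before A n (costs w) k).
Proof.
by elim: k => [//|k IH] /=; rewrite IH /coded_step /= state_codeK.
Qed.

Lemma measurable_coded_run k : measurable_fun setT (coded_run k).
Proof. exact: (measurable_process _ _ (measurable_coded_step n)). Qed.

Lemma measurable_coded_pair k :
  measurable_fun setT (fun w => (coded_run k w, X k w)).
Proof. exact: (measurable_process_pair (measurable_coded_run k)). Qed.

Let mean_value k := \int[P]_w state_value mu n (state_decode (coded_run k w)).

Lemma measurable_value_run k :
  measurable_fun setT (fun w => state_value mu n (state_decode (coded_run k w))).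
Proof.
exact: (measurableT_comp (measurable_state_value n mu) (measurable_coded_run k)).
Qed.

Lemma measurable_cost_run k :
  measurable_fun setT (fun w => coded_cost n k (coded_run k w, X k w)).
Proof.
exact: (measurableT_comp (measurable_coded_cost n k) (measurable_coded_pair k)).
Qed.

(** Averages [state_value_step] over the run; [sample_wait_phase_bound] supplies its phase condition
    at every reachable state. *)
Lemma mean_value_step k : mean_min mu 1 < +oo ->
  \int[P]_w coded_cost n k (coded_run k w, X k w) + mean_value k.+1
  <= mean_value k.
Proof.
move=> fin_mean.
pose f z := coded_cost n k z + state_value mu n (state_decode (coded_step n k z)).
have mf : measurable_fun setT f.
  apply: emeasurable_funD; first exact: measurable_coded_cost.
  exact: (measurableT_comp (measurable_state_value n mu) (measurable_coded_step n k)).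
have f0 z : 0 <= f z by rewrite adde_ge0 ?coded_cost_ge0 ?state_value_ge0.
have -> : \int[P]_w coded_cost n k (coded_run k w, X k w) + mean_value k.+1
        = \int[P]_w f (coded_run k w, X k w).
  rewrite -ge0_integralD//.
  - by move=> w _; exact: coded_cost_ge0.
  - exact: measurable_cost_run.
  - by move=> w _; exact: state_value_ge0.
  - exact: measurable_value_run.
rewrite (expectation_process iidX _ (measurable_coded_step n) k mf f0).
apply: ge0_le_integral_nonmeasurable => w; first by apply: integral_ge0.
rewrite -/(coded_run k w) coded_runE state_codeK.
have := sample_wait_phase_bound (costs w) k n_gt0.
move: (state_before _ _ _ _) => s hs.
apply: le_trans (state_value_step no_atom fin_mean k.+1 hs).
apply: le_of_eq; apply: eq_integral => x _.
by rewrite /f /coded_cost /coded_step !state_codeK.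
Qed.

Lemma sum_cost_le k : mean_min mu 1 < +oo ->
  \sum_(i < k) \int[P]_w coded_cost n i (coded_run i w, X i w) + mean_value k
  <= mean_value 0.
Proof.
move=> fin_mean; elim: k => [|k IH]; first by rewrite big_ord0 add0e.
rewrite big_ord_recr /= -addeA; apply: le_trans IH; apply: leeD2l.
exact: mean_value_step.
Qed.

Lemma expectation_alg_le : mean_min mu 1 < +oo ->
  'E_P[fun w => alg A n (costs w)]
  <= (48 * \sum_(s < n) mean_minr mu s.+1)%:E.
Proof.
move=> fin_mean; rewrite expectation.unlock.
pose total w := \sum_(i < n) coded_cost n i (coded_run i w, X i w).
have alg_total w : (alg A n (costs w))%:E <= total w.
  rewrite /alg /hiring_cost -sumEFin; apply: lee_sum => i _.
  rewrite /coded_cost coded_runE state_codeK EFinM.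
  rewrite lee_wpmul2l ?lee_fin// /pos_part.
  by rewrite le_max lexx.
have total0 w : 0 <= total w.
  by apply: sume_ge0 => i _; exact: coded_cost_ge0.
apply: (@le_trans _ _ (\int[P]_w total w)).
  (* [alg] may be negative; dropping its negative part only increases the expectation. *)
  rewrite integralE; apply: (@le_trans _ _ (\int[P]_w
      (fun w => (alg A n (costs w))%:E)^\+ w)).
    by rewrite -[leRHS]sube0 leeB// integral_ge0.
  apply: ge0_le_integral_nonmeasurable => w; first exact: funepos_ge0.
  by rewrite funeposE ge_max alg_total total0.
rewrite ge0_integral_sum//; first last.
- by move=> i w _; exact: coded_cost_ge0.
- by move=> i; exact: measurable_cost_run.
apply: le_trans (_ : mean_value 0 <= _).
  apply: le_trans (sum_cost_le n fin_mean); apply: leeDl.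
  by apply: integral_ge0 => w _; exact: state_value_ge0.
apply: le_trans (_ : state_value mu n (sw_start R 3 0) <= _); last first.
  apply: le_trans (state_value_start no_atom fin_mean _) _ => //.
  by rewrite lee_fin potential0_le.
rewrite /mean_value (eq_integral (cst (state_value mu n (sw_start R 3 0)))).
  rewrite integral_cst// -[leRHS]mule1; apply: le_of_eq; congr (_ * _).
  exact: probability_setT.
by move=> w _; rewrite coded_runE state_codeK.
Qed.

Let min_run := process X +oo (fun=> fun z : \bar R * R => mine z.1 z.2%:E).

Lemma measurable_min_step (k : nat) :
  measurable_fun setT (fun z : \bar R * R => mine z.1 z.2%:E).
Proof. by apply: measurable_mine => //; exact/measurable_EFinP. Qed.

Lemma measurable_min_run k : measurable_fun setT (min_run k).
Proof. exact: (measurable_process _ _ measurable_min_step). Qed.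

(** Realised samples are exchanged one at a time for integrated ones; each exchange raises [r],
    which is therefore general in the induction. *)
Lemma expectation_min_run r k g : (forall t, 0 <= g t) -> measurable_fun setT g ->
  \int[P]_w running_min_mean mu r g (min_run k w) = running_min_mean mu (r + k) g +oo.
Proof.
move=> g0 mg; elim: k r => [|k IH] r.
  rewrite addn0 (eq_integral (cst (running_min_mean mu r g +oo)))//.
  rewrite integral_cst// -[RHS]mule1; congr (_ * _); exact: probability_setT.
rewrite addnS -addSn -IH.
pose f (z : \bar R * R) := running_min_mean mu r g (mine z.1 z.2%:E).
have mf : measurable_fun setT f.
  apply: (measurableT_comp (measurable_running_min_mean mu r g0 mg)).
  exact: (measurable_min_step 0).
have f0 z : 0 <= f z by exact: running_min_mean_ge0.
exact: (expectation_process iidX +oo measurable_min_step k mf f0).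
Qed.

Lemma min_run_le w i s : (i < s)%N -> min_run s w <= (X i w)%:E.
Proof.
elim: s => // s IH; rewrite ltnS leq_eqVlt => /orP[/eqP->|/IH] /=.
  by rewrite ge_min lexx orbT.
by move=> h; rewrite ge_min h.
Qed.

Lemma negative_cost_null (i : nat) : P (X i @^-1` `]-oo, 0%R[%classic) = 0.
Proof.
have [_ same_law] := iidX.
transitivity (mu `]-oo, 0%R[%classic); first by rewrite -(same_law i).
apply/eqP; rewrite -measure_le0 -mu_nonpos.
apply: le_measure; [by rewrite inE|by rewrite inE|].
by apply: subset_itvl; rewrite bnd_simp.
Qed.

(** A step is covered by an applicant who has already arrived, whose cost is at least the running
    minimum. This bounds [opt] off the null set where some cost is negative. *)
Lemma expectation_opt_ge :
  \sum_(s < n) mean_min mu s.+1 <= 'E_P[fun w => opt n (costs w)].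
Proof.
rewrite expectation.unlock.
pose total w := \sum_(s < n) pos_part (min_run s.+1 w).
have mpos s : measurable_fun setT (fun w => pos_part (min_run s w)).
  exact: (measurableT_comp (@measurable_pos_part R) (measurable_min_run s)).
have total0 w : 0 <= total w by apply: sume_ge0 => s _; exact: pos_part_ge0.
have -> : \sum_(s < n) mean_min mu s.+1 = \int[P]_w total w.
  rewrite ge0_integral_sum//; last by move=> s w _; exact: pos_part_ge0.
  apply: eq_bigr => s _.
  rewrite (expectation_min_run 0 s.+1 (@pos_part_ge0 R) (@measurable_pos_part R)).
  by rewrite add0n.
pose N := \bigcup_(i < n) (X i @^-1` `]-oo, 0%R[%classic).
have mNi i : measurable (X i @^-1` `]-oo, 0%R[%classic).
  exact: measurable_funPTI.
have mN : measurable N by apply: bigcup_measurable.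
have PN : P N = 0.
  apply/eqP; rewrite -measure_le0 /N bigcup_mkord.
  apply: le_trans (Boole_inequality P (n := n) (fun i _ => mNi i)) _.
  by rewrite big1// => i _; exact: negative_cost_null.
have mtotal : measurable_fun setT total by exact: emeasurable_sum.
rewrite (ge0_negligible_integral mN measurableT mtotal _ PN)//.
rewrite integral_mkcond; apply: ge0_le_integral_nonmeasurable => w.
  by rewrite patchE; case: ifP.
(* On the null set the restricted sum is 0 and [opt_ge0] suffices. *)
rewrite patchE; case: ifPn => [|_]; last by rewrite lee_fin opt_ge0.
rewrite inE => -[_ Nw].
have Xge0 i : (i < n)%N -> (0 <= X i w)%R.
  by move=> lin; rewrite leNgt; apply/negP => Xi; apply: Nw; exists i => //=; rewrite in_itv.
have posE s : (s < n)%N -> (fine (pos_part (min_run s.+1 w)))%:E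
    = pos_part (min_run s.+1 w).
  move=> sn; rewrite fineK// ge0_fin_numE ?pos_part_ge0//.
  apply: (@le_lt_trans _ _ (X s w)%:E); last by rewrite ltry.
  by rewrite ge_max min_run_le//= lee_fin Xge0.
rewrite /total (eq_bigr (fun s : 'I_n => (fine (pos_part (min_run s.+1 w)))%:E)).
  rewrite sumEFin lee_fin.
  apply: (opt_ge_sum (m := fun s => fine (pos_part (min_run s.+1 w)))) => //.
  move=> s i /andP[les sn]; rewrite -lee_fin posE// ge_max.
  by rewrite min_run_le//= lee_fin Xge0// (leq_ltn_trans les).
by move=> s _; rewrite posE.
Qed.

(** An infinite denominator gives ratio 0. Otherwise [mean_min mu 1], the first term of the lower
    bound on it, is finite and both estimates apply. *)
Lemma competitive_ratio_le :
  'E_P[fun w => alg A n (costs w)] / 'E_P[fun w => opt n (costs w)] <= 48%:E.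
Proof.
set a := 'E_P[_]; set o := 'E_P[_].
have opt_ge := expectation_opt_ge.
have [->|o_fin] := eqVneq o +oo; first by rewrite invey mule0 lee_fin.
have sum_ge0 : 0 <= \sum_(s < n) mean_min mu s.+1.
  by apply: sume_ge0 => s _; exact: mean_min_ge0.
have o0 : 0 <= o by exact: le_trans opt_ge.
have ofin : o \is a fin_num by rewrite ge0_fin_numE// lt_neqAle o_fin leey.
have fin_mean : mean_min mu 1 < +oo.
  apply: (@le_lt_trans _ _ o); last by rewrite lt_neqAle o_fin leey.
  apply: le_trans opt_ge; case: (n) n_gt0 => // m _.
  rewrite big_ord_recl leeDl//; apply: sume_ge0 => s _; exact: mean_min_ge0.
have a_le : a <= 48%:E * o.
  apply: le_trans (expectation_alg_le fin_mean) _.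
  rewrite EFinM lee_pmul ?lee_fin//.
    by apply: sumr_ge0 => s _; exact: mean_minr_ge0.
  apply: le_trans opt_ge; rewrite -sumEFin; apply: lee_sum => s _.
  by rewrite mean_minrE.
move: (fine o) (fineK ofin) => r rE; rewrite -rE in o0 a_le *.
rewrite lee_fin in o0; move: o0; rewrite le_eqVlt => /orP[/eqP r0|r0].
  (* The inverse of 0 is [+oo] and the numerator is at most 0, so the ratio is 0 or [-oo]. *)
  rewrite -r0 mule0 in a_le *; rewrite inve0.
  move: a_le; rewrite le_eqVlt => /orP[/eqP->|a0].
    by rewrite mul0e lee_fin.
  by rewrite lt0_muley// leNye.
by rewrite inver gt_eqF// lee_pdivrMr.
Qed.

End competitive_ratio.

Theorem theorem6p3 (R : realType) :
  always_feasible (sample_wait_algorithm R 3) /\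
  forall (mu : probability R R),
    mu `[0, +oo[%classic = 1%E ->
    continuous (fun r : R => mu `]-oo, r]%classic) ->
    mu `]-oo, 0]%classic = 0%E ->
    forall (d : measure_display) (T : measurableType d) (P : probability T R)
      (X : nat -> {RV P >-> R}),
      iid mu X -> strictly_competitive X (sample_wait_algorithm R 3) 48.
Proof.
split; first exact: sample_wait_feasible.
move=> mu _ /continuous_cdf_no_atom no_atom mu_nonpos d T P X iidX.
by apply: ge_ereal_sup => _ [n n_gt0 <-]; exact: competitive_ratio_le iidX _ _.
Qed.
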